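(* Let $\mathsf{M}$ be a sparse paving matroid of rank $k\geq1$ and cardinality $n$, having exactly $\lambda$ circuit-hyperplanes. Then \[P_{\mathsf{M}}(t)=P_{\mathsf{U}_{k,n}}(t)-\lambda p_k(t),\qquad Q_{\mathsf{M}}(t)=Q_{\mathsf{U}_{k,n}}(t)-\lambda q_k(t),\qquad Z_{\mathsf{M}}(t)=Z_{\mathsf{U}_{k,n}}(t)-\lambda z_k(t).\]
   Context: A matroid of rank $k$ is paving if all its circuits have size at least $k$, and sparse paving if moreover all its hyperplanes have size at most $k$. $\mathsf{U}_{k,n}$ is the uniform matroid of rank $k$ on $n$ elements. A circuit-hyperplane is a subset that is both a circuit and a hyperplane; the relaxation of a matroid by a circuit-hyperplane $H$ is the matroid on the same ground set whose bases are the original bases together with $H$. For a matroid $\mathsf{M}$ on $E$ with rank function $\operatorname{rk}$, $\mathscr{L}(\mathsf{M})$ is its set of flats; for a flat $F$, $\mathsf{M}^F$ is the restriction to $F$ and $\mathsf{M}_F$ the contraction by $F$ (ground set $E\smallsetminus F$, rank $A\mapsto\operatorname{rk}(A\cup F)-\operatorname{rk}(F)$); $\chi_{\mathsf{M}}(t)=\sum_{A\subseteq E}(-1)^{|A|}t^{\operatorname{rk}(\mathsf{M})-\operatorname{rk}(A)}$. $P_{\mathsf{M}}\in\mathbb{Z}[t]$ (Kazhdan--Lusztig polynomial) is uniquely determined by: (1) if $\operatorname{rk}(\mathsf{M})=0$, $P_{\mathsf{M}}=1$ if $E=\varnothing$ and $0$ otherwise; (2) if $\operatorname{rk}(\mathsf{M})>0$,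 $\deg P_{\mathsf{M}}<\operatorname{rk}(\mathsf{M})/2$; (3) $t^{\operatorname{rk}(\mathsf{M})}P_{\mathsf{M}}(t^{-1})=\sum_{F\in\mathscr{L}(\mathsf{M})}\chi_{\mathsf{M}^F}(t)P_{\mathsf{M}_F}(t)$. $Q_{\mathsf{M}}$ (inverse Kazhdan--Lusztig polynomial) is uniquely determined by (1),(2) with $Q$ in place of $P$ and (3') $(-t)^{\operatorname{rk}(\mathsf{M})}Q_{\mathsf{M}}(t^{-1})=\sum_{F\in\mathscr{L}(\mathsf{M})}(-1)^{\operatorname{rk}(F)}Q_{\mathsf{M}^F}(t)t^{\operatorname{rk}(\mathsf{M})-\operatorname{rk}(F)}\chi_{\mathsf{M}_F}(t^{-1})$. $Z_{\mathsf{M}}(t)=\sum_{F\in\mathscr{L}(\mathsf{M})}t^{\operatorname{rk}(F)}P_{\mathsf{M}_F}(t)$. For $k\ge1$, $p_k,q_k,z_k\in\mathbb{Z}[t]$ are the (uniquely determined) polynomials such that for every matroid $\mathsf{N}$ of rank $k$ with a circuit-hyperplane and $\widetilde{\mathsf{N}}$ its relaxation, $P_{\widetilde{\mathsf{N}}}=P_{\mathsf{N}}+p_k$, $Q_{\widetilde{\mathsf{N}}}=Q_{\mathsf{N}}+q_k$, $Z_{\widetilde{\mathsf{N}}}=Z_{\mathsf{N}}+z_k$. *)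

(* Defs.v *)
From HB Require Import structures.
From mathcomp Require Import all_boot all_order all_algebra.
From mathcomp Require Import zify.

Set Implicit Arguments.
Unset Strict Implicit.
Unset Printing Implicit Defensive.

Import GRing.Theory.
Local Open Scope ring_scope.

(** Rank-function axioms for a matroid whose ground set [E] is a subset of an
    ambient finite type.  The rank function is stored on all subsets of that
    type; the first clause says that elements outside [E] do not count, so that
    two matroids with the same ground set and the same ranks are equal. *)
Definition matroid_axiom (T : finType) (E : {set T})
    (r : {ffun {set T} -> nat}) : bool :=
  [&& [forall A : {set T}, r (A :&: E) == r A],
      [forall A : {set T}, (r A <= #|A|)%N],
      [forall A : {set T}, forall B : {set T},
         (A \subset B) ==> (r A <= r B)%N]
    & [forall A : {set T}, forall B : {set T},
         (r (A :|: B) + r (A :&: B) <= r A + r B)%N]].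

Record matroid (T : finType) := Matroid {
  ground : {set T};
  rk : {ffun {set T} -> nat};
  matroidP : matroid_axiom ground rk }.

Section MatroidNotions.
Variables (T : finType) (M : matroid T).
Implicit Types A B C F H : {set T}.

Definition rank : nat := rk M (ground M).

Definition indep A : bool := (A \subset ground M) && (rk M A == #|A|).

Definition bases : {set {set T}} := [set B | maxset indep B].

Definition circuit C : bool :=
  minset [pred A : {set T} | (A \subset ground M) && ~~ indep A] C.

Definition flat F : bool :=
  (F \subset ground M) &&
  [forall x in ground M :\: F, (rk M F < rk M (x |: F))%N].

Definition hyperplane H : bool := flat H && ((rk M H).+1 == rank).

Definition circuit_hyperplane H : bool := circuit H && hyperplane H.

Definition paving : Prop := forall C, circuit C -> (rank <= #|C|)%N.

Definition sparse_paving : Prop :=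
  paving /\ forall H, hyperplane H -> (#|H| <= rank)%N.

Lemma rkI A : rk M (A :&: ground M) = rk M A.
Proof. by have /and4P[/forallP/(_ A)/eqP] := matroidP M. Qed.

Lemma rk_card A : (rk M A <= #|A|)%N.
Proof. by have /and4P[_ /forallP/(_ A)] := matroidP M. Qed.

Lemma rkS A B : A \subset B -> (rk M A <= rk M B)%N.
Proof.
by have /and4P[_ _ /forallP/(_ A)/forallP/(_ B)/implyP] := matroidP M.
Qed.

Lemma rk_submod A B :
  (rk M (A :|: B) + rk M (A :&: B) <= rk M A + rk M B)%N.
Proof. by have /and4P[_ _ _ /forallP/(_ A)/forallP/(_ B)] := matroidP M. Qed.

Definition restrict_rk F : {ffun {set T} -> nat} :=
  [ffun A : {set T} => rk M (A :&: F)].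

Lemma restrict_axiom F : matroid_axiom (ground M :&: F) (restrict_rk F).
Proof.
apply/and4P; split; apply/forallP => A.
- rewrite !ffunE -[X in _ == X]rkI; apply/eqP; congr (rk M _); apply/setP => x.
  by rewrite !inE; case: (x \in A); case: (x \in F); case: (x \in ground M).
- by rewrite ffunE (leq_trans (rk_card _)) // subset_leq_card // subsetIl.
- apply/forallP => B; apply/implyP => sAB; rewrite !ffunE.
  exact/rkS/setSI.
- apply/forallP => B; rewrite !ffunE setIUl.
  rewrite (_ : A :&: B :&: F = (A :&: F) :&: (B :&: F)); last first.
    by rewrite setIACA setIid.
  exact: rk_submod.
Qed.

Definition restrict F : matroid T := Matroid (restrict_axiom F).

Definition contract_rk F : {ffun {set T} -> nat} :=
  [ffun A : {set T} => (rk M (A :|: F) - rk M F)%N].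

Lemma contract_axiom F : matroid_axiom (ground M :\: F) (contract_rk F).
Proof.
apply/and4P; split; apply/forallP => A.
- rewrite !ffunE; apply/eqP; congr (_ - _)%N.
  rewrite -[LHS]rkI -[RHS]rkI; congr (rk M _); apply/setP => x.
  by rewrite !inE; case: (x \in A); case: (x \in F); case: (x \in ground M).
- rewrite ffunE leq_subLR addnC.
  have := rk_submod A F; have := rk_card A; lia.
- apply/forallP => B; apply/implyP => sAB; rewrite !ffunE.
  exact/leq_sub2r/rkS/setSU.
- apply/forallP => B; rewrite !ffunE.
  have := rk_submod (A :|: F) (B :|: F).
  rewrite -setUUl -setUIl.
  have h D : (rk M F <= rk M (D :|: F))%N by apply/rkS/subsetUr.
  have := h A; have := h B; have := h (A :|: B); have := h (A :&: B); lia.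
Qed.

Definition contract F : matroid T := Matroid (contract_axiom F).

Definition charpoly : {poly int} :=
  \sum_(A : {set T} | A \subset ground M)
    (-1) ^+ #|A| * 'X^(rank - rk M A).

End MatroidNotions.

Definition circuit_hyperplanes (T : finType) (M : matroid T) : {set {set T}} :=
  [set H | circuit_hyperplane M H].

Definition uniform_rk (k n : nat) : {ffun {set 'I_n} -> nat} :=
  [ffun A : {set 'I_n} => minn #|A| k].

Lemma uniform_axiom k n : matroid_axiom [set: 'I_n] (uniform_rk k n).
Proof.
apply/and4P; split; apply/forallP => A.
- by rewrite setIT.
- by rewrite ffunE geq_minl.
- apply/forallP => B; apply/implyP => /subset_leq_card; rewrite !ffunE; lia.
- apply/forallP => B; rewrite !ffunE.
  have := cardsUI A B; have := subset_leq_card (subsetIl A B).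
  have := subset_leq_card (subsetIr A B); lia.
Qed.

(** The uniform matroid of rank [k] on [n] elements, for [k <= n]. *)
Definition uniform (k n : nat) : matroid 'I_n := Matroid (uniform_axiom k n).

Definition relaxation (T : finType) (N : matroid T) (H : {set T})
    (N' : matroid T) : Prop :=
  [/\ circuit_hyperplane N H, ground N' = ground N & bases N' = H |: bases N].

(** [rev_poly r f] is [t^r f(t^-1)], for [f] of degree at most [r]. *)
Definition rev_poly (r : nat) (f : {poly int}) : {poly int} :=
  \poly_(i < r.+1) f`_(r - i).

Definition matroid_poly := forall T : finType, matroid T -> {poly int}.

(** Normalization and degree bound, shared by both kinds of Kazhdan-Lusztig
    polynomials; as [size f] is one more than the degree of [f], the bound
    reads [deg f < rank / 2].  The degree bound is what makes [rev_poly] below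
    the actual Laurent substitution. *)
Definition KL_normalized (P : matroid_poly) : Prop :=
  forall (T : finType) (M : matroid T),
    (rank M = 0%N -> P T M = if ground M == set0 then 1 else 0) /\
    ((0 < rank M)%N -> ((size (P T M)).-1.*2 < rank M)%N).

(** These determine [P] (resp. [Q]) uniquely, by induction on the ground set. *)
Definition is_KL (P : matroid_poly) : Prop :=
  KL_normalized P /\
  forall (T : finType) (M : matroid T),
    rev_poly (rank M) (P T M) =
    \sum_(F : {set T} | flat M F)
      charpoly (restrict M F) * P T (contract M F).

Definition is_inverse_KL (Q : matroid_poly) : Prop :=
  KL_normalized Q /\
  forall (T : finType) (M : matroid T),
    (-1) ^+ rank M * rev_poly (rank M) (Q T M) =
    \sum_(F : {set T} | flat M F)
      (-1) ^+ rk M F * Q T (restrict M F)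
        * rev_poly (rank M - rk M F) (charpoly (contract M F)).

Definition Zpoly (P : matroid_poly) : matroid_poly := fun T M =>
  \sum_(F : {set T} | flat M F) 'X^(rk M F) * P T (contract M F).

(** [p] is the amount by which the invariant [f] of a matroid of rank [k]
    changes under relaxation of a circuit-hyperplane.  There is at most one such
    [p] when [0 < k], since some matroid of rank [k] has a circuit-hyperplane. *)
Definition relaxation_increment (f : matroid_poly) (k : nat)
    (p : {poly int}) : Prop :=
  forall (T : finType) (N N' : matroid T) (H : {set T}),
    rank N = k -> relaxation N H N' -> f T N' = f T N + p.

(* Main.v *)
(** The defining recursions determine [P] and [Q] by induction on the size of
    the ground set, so [P], [Q] and [Z] are invariant under isomorphism.  In a
    sparse paving matroid of rank [k] a set [A] has rank [min(|A|, k)] unless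
    [|A| = k], and the [k]-sets of smaller rank are exactly the
    circuit-hyperplanes.  Relaxing one of them keeps this shape and removes it
    from the list; relaxing them all in turn leaves the rank function of the
    uniform matroid, and each step adds one increment. *)

Require Import Defs.
From HB Require Import structures.
From mathcomp Require Import all_boot all_order all_algebra.
From mathcomp Require Import zify.

Set Implicit Arguments.
Unset Strict Implicit.
Unset Printing Implicit Defensive.

Import GRing.Theory.
Local Open Scope ring_scope.

(** * Elementary identities for minors, and coefficient reversal *)

Lemma matroid_eq (T : finType) (M N : matroid T) :
  ground M = ground N -> rk M = rk N -> M = N.
Proof.
case: M N => E r h [E' r' h'] /= eE er; subst E' r'.
by congr Matroid; apply: bool_irrelevance.
Qed.

Lemma rk_set0 (T : finType) (M : matroid T) : rk M set0 = 0%N.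
Proof. by apply/eqP; rewrite -leqn0 -(cards0 T) rk_card. Qed.

Lemma contract_set0 (T : finType) (M : matroid T) : contract M set0 = M.
Proof.
apply: matroid_eq => /=; first by rewrite setD0.
by apply/ffunP => A; rewrite ffunE setU0 rk_set0 subn0.
Qed.

Lemma restrict_ground (T : finType) (M : matroid T) :
  restrict M (ground M) = M.
Proof.
apply: matroid_eq => /=; first by rewrite setIid.
by apply/ffunP => A; rewrite ffunE rkI.
Qed.

Lemma rk_le_rank (T : finType) (M : matroid T) A : (rk M A <= rank M)%N.
Proof. by rewrite -rkI rkS ?subsetIr. Qed.

Lemma charpoly_ground0 (T : finType) (M : matroid T) :
  ground M = set0 -> charpoly M = 1.
Proof.
move=> E0; rewrite /charpoly E0 (bigD1 set0) ?sub0set //= cards0 expr0 mul1r.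
rewrite /rank E0 rk_set0 expr0 big1 ?addr0 // => A.
by rewrite subset0 => /andP[->].
Qed.

Lemma rev_poly1 : rev_poly 0 1 = 1.
Proof. by apply/polyP => -[|i]; rewrite coef_poly !coef1. Qed.

(* Reversal in degree [r] exchanges the coefficients below [r / 2] with those
   above, and only the former may be nonzero. *)
Lemma rev_poly_inj_low (r m : nat) (f g : {poly int}) :
  ((size f).-1.*2 < r)%N -> ((size g).-1.*2 < r)%N ->
  rev_poly r f - rev_poly r g = (f - g) *+ m -> f = g.
Proof.
move=> sf sg e.
have hi (h : {poly int}) i :
    ((size h).-1.*2 < r)%N -> (r <= i.*2)%N -> h`_i = 0.
  move=> sh ri; apply: nth_default. move: sh; move: (size h) => s sh; lia.
apply/polyP => i; case: (leqP r i.*2) => [ri|ir]; first by rewrite !hi.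
have := congr1 (coefp (r - i)) e; rewrite /= coefMn !coefB !coef_poly.
have -> : (r - i < r.+1)%N by lia.
rewrite (hi f (r - i)%N) ?(hi g (r - i)%N) //; try lia.
rewrite (_ : r - (r - i) = i)%N; last by lia.
by rewrite subrr mul0rn => /eqP; rewrite subr_eq0 => /eqP.
Qed.

(** * Isomorphism invariance *)

(** An isomorphism between matroids living in different ambient types. Since [f] is defined on all
    of [T], the same map serves for every minor of [M]. *)
Definition embedding (T T' : finType) (f : T -> T')
    (M : matroid T) (M' : matroid T') : Prop :=
  [/\ injective f, f @: ground M = ground M'
    & forall A : {set T}, A \subset ground M -> rk M' (f @: A) = rk M A].

Definition iso_invariant (P : matroid_poly) : Prop :=
  forall (T T' : finType) (f : T -> T') (M : matroid T) (M' : matroid T'),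
    embedding f M M' -> P T' M' = P T M.

Section Embedding.
Variables (T T' : finType) (f : T -> T') (M : matroid T) (M' : matroid T').
Hypothesis fM : embedding f M M'.
Implicit Types A F : {set T}.

Let f_inj : injective f. Proof. by case: fM. Qed.

Lemma embedding_subset A (B : {set T}) :
  (f @: A \subset f @: B) = (A \subset B).
Proof.
apply/idP/idP; last exact: imsetS.
move=> /subsetP s; apply/subsetP => x xA.
by rewrite -(mem_imset B x f_inj) s // mem_imset.
Qed.

Lemma embedding_rank : rank M' = rank M.
Proof. by rewrite /rank; case: fM => _ <- ->. Qed.

Lemma embedding_flat F : F \subset ground M -> flat M' (f @: F) = flat M F.
Proof.
case: fM => _ eE er sF; rewrite /flat -eE embedding_subset sF /=.
apply/forall_inP/forall_inP => [h x|h y].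
- rewrite inE => /andP[xF xE]; have := h (f x).
  rewrite inE !mem_imset // xF xE => /(_ isT).
  by rewrite -imsetU1 !er // subUset sub1set xE.
- rewrite inE => /andP[yF /imsetP[x xE ey]]; rewrite ey -imsetU1 !er //.
    apply: h; rewrite inE xE andbT.
    by apply: contra yF => xF; rewrite ey mem_imset.
  by rewrite subUset sub1set xE.
Qed.

(** Image and preimage under [f] are inverse bijections between the subsets of the two ground sets.
    The index predicates stay abstract so that sums over all subsets and sums over flats are both
    covered. *)
Lemma reindex_embedding (P : pred {set T}) (P' : pred {set T'})
    (G : {set T} -> {poly int}) (G' : {set T'} -> {poly int}) :
  (forall A, P A -> A \subset ground M) ->
  (forall B, P' B -> B \subset ground M') ->
  (forall A, A \subset ground M -> P' (f @: A) = P A) ->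
  (forall A, P A -> G' (f @: A) = G A) ->
  \sum_(B | P' B) G' B = \sum_(A | P A) G A.
Proof.
move=> sP sP' eP eG.
have fK A : f @^-1: (f @: A) = A.
  by apply/setP => x; rewrite inE mem_imset.
rewrite (reindex_onto (fun A => f @: A) (fun B => f @^-1: B)) /=.
  have eqP A : P' (f @: A) && (f @^-1: (f @: A) == A) = P A.
    rewrite fK eqxx andbT; case: (boolP (A \subset ground M)) => [/eP //|nA].
    apply/idP/idP => [/sP'|/sP sA]; last by rewrite sA in nA.
    by case: fM => _ <- _; rewrite embedding_subset (negPf nA).
  by apply: eq_big => // A; rewrite eqP => /eG.
(* A subset of [ground M'] is the image of its preimage, because [f] maps [ground M] onto
   [ground M']. *)
move=> B /sP'; case: fM => _ <- _ /subsetP sB.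
apply/setP => y; apply/imsetP/idP => [[x] + ->|yB]; first by rewrite inE.
by case/imsetP: (sB y yB) => x _ e; exists x => //; rewrite inE -e.
Qed.

Lemma embedding_restrict F : F \subset ground M ->
  embedding f (restrict M F) (restrict M' (f @: F)).
Proof.
case: fM => _ eE er sF; split => //= [|A _].
  by rewrite imsetI ?eE //; move=> x y _ _; apply: f_inj.
rewrite !ffunE -imsetI; last by move=> x y _ _; apply: f_inj.
by rewrite er // (subset_trans (subsetIr _ _)).
Qed.

Lemma embedding_contract F : F \subset ground M ->
  embedding f (contract M F) (contract M' (f @: F)).
Proof.
case: fM => _ eE er sF; split => //= [|A sA].
  rewrite -eE; apply/setP => y; rewrite inE.
  apply/imsetP/andP => [[x]|[yF /imsetP[x xE e]]].
    by rewrite inE => /andP[xF xE] ->; rewrite !mem_imset.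
  exists x; rewrite // inE xE andbT.
    by apply: contra yF => xF; rewrite e mem_imset.
rewrite !ffunE -imsetU !er // subUset sF andbT.
exact: subset_trans sA (subsetDl _ _).
Qed.

Lemma embedding_charpoly : charpoly M' = charpoly M.
Proof.
case: fM => _ eE er.
apply: reindex_embedding => // A sA; first by rewrite -eE embedding_subset.
by rewrite card_imset // embedding_rank er.
Qed.

Lemma sum_flat_embedding (G : {set T} -> {poly int})
    (G' : {set T'} -> {poly int}) :
  (forall F, flat M F -> G' (f @: F) = G F) ->
  \sum_(F | flat M' F) G' F = \sum_(F | flat M F) G F.
Proof.
move=> eG; apply: reindex_embedding => //; first by move=> A /andP[].
- by move=> A /andP[].
- exact: embedding_flat.
Qed.

End Embedding.

(** Induction on the size of the ground set. When the recursions for [M'] and [M] are subtracted,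
    every term with [F] nonempty cancels, as contracting [F] shrinks the ground set. Only a multiple
    of [P T' M' - P T M] is left, and the degree bound forces it to vanish. *)
Lemma is_KL_iso_invariant P : is_KL P -> iso_invariant P.
Proof.
case=> norm rec T T' f M M' fM.
elim: {M}_.+1 {-2}M (ltnSn #|ground M|) M' fM => // m IH M leM M' fM.
have eR := embedding_rank fM; have [f_inj eE er] := fM.
case: (posnP (rank M)) => [r0|rpos].
  rewrite (norm _ M).1 // (norm _ M').1 ?eR // -eE imset_eq0.
  by case: (ground M == set0).
(* This multiplicity is 1 or 0 according to whether [set0] is a flat, that is, whether [M] has no
   loops. As a sum it covers both cases and can be compared flat by flat. *)
apply: (@rev_poly_inj_low (rank M) (\sum_(F | flat M F) (F == set0))).
- by have := (norm _ M').2; rewrite eR; apply.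
- exact: (norm _ M).2.
rewrite -{1}eR !rec.
rewrite (sum_flat_embedding fM (G := fun F => charpoly (restrict M F) *
  P T' (contract M' (f @: F)))); last first.
  move=> F /andP[sF _]; congr (_ * _).
  exact: embedding_charpoly (embedding_restrict fM sF).
rewrite -sumrB -sumrMnr; apply: eq_bigr => F /andP[sF _]; rewrite -mulrBr.
have [->|nF] := eqVneq F set0.
  rewrite imset0 !contract_set0 charpoly_ground0 ?mul1r //=.
  by rewrite setI0.
rewrite (IH _ _ _ (embedding_contract fM sF)) ?subrr ?mulr0 //=.
rewrite cardsD (setIidPr sF).
apply: leq_trans (_ : #|ground M| <= _)%N => //.
by rewrite ltn_subrL card_gt0 nF (leq_trans _ (subset_leq_card sF)) // card_gt0.
Qed.

(** The induction is dual to the one for [P]: restriction to a flat other than [ground M] shrinks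
    the ground set, so [F = ground M] gives the only surviving term. *)
Lemma is_inverse_KL_iso_invariant Q : is_inverse_KL Q -> iso_invariant Q.
Proof.
case=> norm rec T T' f M M' fM.
elim: {M}_.+1 {-2}M (ltnSn #|ground M|) M' fM => // m IH M leM M' fM.
have eR := embedding_rank fM; have [f_inj eE er] := fM.
case: (posnP (rank M)) => [r0|rpos].
  rewrite (norm _ M).1 // (norm _ M').1 ?eR // -eE imset_eq0.
  by case: (ground M == set0).
apply: (@rev_poly_inj_low (rank M) (\sum_(F | flat M F) (F == ground M))).
- by have := (norm _ M').2; rewrite eR; apply.
- exact: (norm _ M).2.
(* Multiplying by the sign restores the left side of the recursion; the term at [ground M] carries
   the same sign. *)
apply: (can_inj (signrMK (rank M))).
rewrite mulrBr -{1 2}eR !rec.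
rewrite (sum_flat_embedding fM (G := fun F =>
  (-1) ^+ rk M F * Q T' (restrict M' (f @: F)) *
  rev_poly (rank M - rk M F) (charpoly (contract M F)))); last first.
  move=> F /andP[sF _]; rewrite eR er //; congr (_ * _ * rev_poly _ _).
  exact: embedding_charpoly (embedding_contract fM sF).
rewrite -sumrB -sumrMnr mulr_sumr; apply: eq_bigr => F /andP[sF _].
rewrite -mulrBl -mulrBr.
have [->|nF] := eqVneq F (ground M).
  rewrite eE !restrict_ground subnn charpoly_ground0 ?rev_poly1 ?mulr1 //=.
  by rewrite setDv.
rewrite (IH _ _ _ (embedding_restrict fM sF)) ?subrr ?mulr0 ?mul0r //=.
rewrite (setIidPr sF); apply: leq_trans (_ : #|ground M| <= _)%N => //.
by rewrite proper_card // properEneq nF.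
Qed.

Lemma Zpoly_iso_invariant P : iso_invariant P -> iso_invariant (Zpoly P).
Proof.
move=> invP T T' f M M' fM; apply: (sum_flat_embedding fM) => F /andP[sF _].
have [_ _ er] := fM; rewrite er // (invP _ _ _ _ _ (embedding_contract fM sF)).
by [].
Qed.

(** * Relaxation of a circuit-hyperplane *)

(** Remove [x] from [A] and apply submodularity to [(A :\ x) :|: B] and [x |: B]: both have the rank
    of [B], and so does their intersection, which contains [B]. *)
Lemma rk_closure (T : finType) (M : matroid T) (A B : {set T}) :
  (forall x, x \in A -> rk M (x |: B) = rk M B) -> rk M (A :|: B) = rk M B.
Proof.
elim: {A}_.+1 {-2}A (ltnSn #|A|) => // m IH A leA h.
have [->|[x xA]] := set_0Vmem A; first by rewrite set0U.
have e : rk M ((A :\ x) :|: B) = rk M B.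
  apply: IH => [|y /setD1P[_ /h]//].
  by rewrite (cardsD1 x A) xA in leA.
apply/eqP; rewrite eqn_leq [X in _ && X]rkS ?subsetUr // andbT.
have := rk_submod M ((A :\ x) :|: B) (x |: B).
have -> : A :\ x :|: B :|: (x |: B) = A :|: B.
  apply/setP => y; rewrite !inE; case: eqVneq => [->|_]; rewrite ?xA ?orbT //=.
  by case: (y \in A); case: (y \in B).
have : (rk M B <= rk M ((A :\ x :|: B) :&: (x |: B)))%N.
  by apply: rkS; rewrite subsetI !subsetUr.
rewrite e h //. lia.
Qed.

(** Translates bases, in terms of which [relaxation] is stated, into ranks. No element raises the
    rank of a maximal independent set, so by [rk_closure] that set has full rank. *)
Lemma mem_bases (T : finType) (M : matroid T) (B : {set T}) :
  (B \in bases M) = [&& B \subset ground M, rk M B == #|B| & #|B| == rank M].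
Proof.
rewrite inE; apply/maxsetP/and3P => [[/andP[sB /eqP rB] maxB]|[sB rB /eqP cB]].
  split=> //; first exact/eqP.
  rewrite -rB /rank -(setUidPl sB); apply/eqP/esym/rk_closure => x xE.
  have [xB|xB] := boolP (x \in B); first by rewrite (setUidPr _) // sub1set.
  have := rk_card M (x |: B); rewrite cardsU1 xB => r1.
  have r2 : (rk M B <= rk M (x |: B))%N by apply/rkS/subsetUr.
  have [e|ne] := eqVneq (rk M (x |: B)) (#|B|.+1); last by lia.
  have e' : x |: B = B.
    apply: maxB; last exact: subsetUr.
    by rewrite /indep subUset sub1set xE sB cardsU1 xB e eqxx.
  by rewrite -e' setU11 in xB.
split=> [|A /andP[sA /eqP rA] sBA]; first by rewrite /indep sB.
by apply/esym/eqP; rewrite eqEcard sBA cB -rA rk_le_rank.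
Qed.

Section Relaxation.
Variables (T : finType) (M : matroid T) (H : {set T}).
Hypothesis chH : circuit_hyperplane M H.
Implicit Types A B : {set T}.

Let sHE : H \subset ground M.
Proof. by case/andP: chH => _ /andP[/andP[]]. Qed.

Let rkH : (rk M H).+1 = rank M.
Proof. by case/andP: chH => _ /andP[_ /eqP]. Qed.

Lemma rk_proper_circuit A : A \proper H -> rk M A = #|A|.
Proof.
case/andP: chH => /minsetP[_ minH] _ pA.
have sA := subset_trans (proper_sub pA) sHE.
apply/eqP; apply: contraTT pA => rA; rewrite properE negb_and negbK.
case: (boolP (A \subset H)) => //= sAH; suff <- : A = H by [].
by apply: minH; rewrite //= /indep sA.
Qed.

Lemma rk_super_hyperplane A : H \proper A :&: ground M -> rk M A = rank M.
Proof.
case/andP: chH => _ /andP[/andP[_ /forall_inP flatH] _].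
case/properP => sH [x xA xH]; apply/eqP; rewrite eqn_leq rk_le_rank -rkH /=.
apply: leq_trans (flatH x _) _.
  by rewrite inE xH; case/setIP: xA.
by rewrite -[leqRHS]rkI rkS // subUset sub1set xA.
Qed.

(** A circuit is nonempty and loses its dependence with any one element, so [rk M H] is [#|H| - 1];
    for a hyperplane it is also [rank M - 1]. *)
Lemma card_circuit_hyperplane : #|H| = rank M.
Proof.
case/andP: chH => /minsetP[/andP[_ dep] _] _.
have [H0|[x xH]] := set_0Vmem H.
  by move: dep; rewrite /indep sHE H0 rk_set0 cards0 eqxx.
have := rk_proper_circuit (properD1 xH); have := rkS M (subsetDl H [set x]).
move: dep; rewrite /indep sHE /= -rkH.
by have := rk_card M H; have := cardsD1 x H; rewrite xH; lia.
Qed.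

(** Only the rank of [H] is raised, by one. The intersection with [ground M] is there because ranks
    are stored for all subsets of [T]. *)
Definition relax_rk : {ffun {set T} -> nat} :=
  [ffun A : {set T} => if A :&: ground M == H then rank M else rk M A].

Lemma relax_rk_le A : (relax_rk A <= rank M)%N.
Proof. by rewrite ffunE; case: ifP; rewrite // rk_le_rank. Qed.

(** The raised value at [H] does no harm: a set strictly above a hyperplane already has full
    rank. *)
Lemma relax_rkS A B : A \subset B -> (relax_rk A <= relax_rk B)%N.
Proof.
move=> sAB; rewrite [relax_rk B]ffunE; case: eqVneq => [_|nB].
  exact: relax_rk_le.
rewrite ffunE; case: eqVneq => [eA|_]; last exact: rkS.
by rewrite (rk_super_hyperplane (A := B)) // properEneq eq_sym nB -eA setSI.
Qed.

Lemma relax_submod A B :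
  (relax_rk (A :|: B) + relax_rk (A :&: B) <= relax_rk A + relax_rk B)%N.
Proof.
(* If one of the two sets is [H], its new rank is maximal and bounds that of the union; monotonicity
   bounds that of the intersection. *)
have big X Y : X :&: ground M = H -> (relax_rk (X :|: Y) + relax_rk (X :&: Y)
    <= relax_rk X + relax_rk Y)%N.
  move=> eX; apply: leq_add; last exact/relax_rkS/subsetIr.
  by rewrite [leqRHS]ffunE eX eqxx relax_rk_le.
have [eA|nA] := eqVneq (A :&: ground M) H; first exact: big.
have [eB|nB] := eqVneq (B :&: ground M) H.
  by rewrite setUC setIC addnC addnC [leqRHS]addnC big.
have [eI|nI] := eqVneq (A :&: B :&: ground M) H.
  (* If the intersection is [H], both sets lie strictly above a hyperplane and have full rank. *)
  have pA : H \proper A :&: ground M.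
    by rewrite properEneq eq_sym nA -eI setSI // subsetIl.
  have pB : H \proper B :&: ground M.
    by rewrite properEneq eq_sym nB -eI setSI // subsetIr.
  rewrite [relax_rk A]ffunE [relax_rk B]ffunE (negPf nA) (negPf nB).
  rewrite !rk_super_hyperplane //.
  exact: leq_add (relax_rk_le _) (relax_rk_le _).
rewrite [relax_rk A]ffunE [relax_rk B]ffunE [relax_rk (A :&: B)]ffunE.
rewrite (negPf nA) (negPf nB) (negPf nI) ffunE.
case: eqVneq => [eU|_]; last exact: rk_submod.
(* If the union is [H], both sets are proper subsets of a circuit. All ranks involved are then
   cardinalities, and equality holds. *)
have pA : A :&: ground M \proper H.
  by rewrite properEneq nA -eU setSI // subsetUl.
have pB : B :&: ground M \proper H.
  by rewrite properEneq nB -eU setSI // subsetUr.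
rewrite -(rkI M A) -(rkI M B) -(rkI M (A :&: B)) -card_circuit_hyperplane.
rewrite (rk_proper_circuit pA) (rk_proper_circuit pB) -eU setIUl setIIl.
rewrite rk_proper_circuit ?cardsUI //.
exact: sub_proper_trans (subsetIl _ _) pA.
Qed.

Lemma relax_axiom : matroid_axiom (ground M) relax_rk.
Proof.
apply/and4P; split; apply/forallP => A.
- by rewrite !ffunE -setIA setIid rkI.
- rewrite ffunE; case: eqVneq => [eA|_]; last exact: rk_card.
  by rewrite -card_circuit_hyperplane -eA subset_leq_card // subsetIl.
- by apply/forallP => B; apply/implyP; apply: relax_rkS.
- by apply/forallP => B; apply: relax_submod.
Qed.

Definition relax : matroid T := Matroid relax_axiom.

Lemma rk_relax A : A \subset ground M ->
  rk relax A = if A == H then rank M else rk M A.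
Proof. by move=> sA; rewrite ffunE (setIidPl sA). Qed.

Lemma rank_relax : rank relax = rank M.
Proof. by rewrite /rank /= ffunE; case: ifP. Qed.

Lemma relaxation_relax : relaxation M H relax.
Proof.
split=> //; apply/setP => B; rewrite in_setU1 !mem_bases rank_relax /=.
have [->|nB] := eqVneq B H.
  by rewrite sHE rk_relax ?sHE // eqxx card_circuit_hyperplane !eqxx.
by case: (boolP (B \subset ground M)) => //= sB; rewrite rk_relax // (negPf nB).
Qed.

End Relaxation.

(** * Sparse paving matroids *)

Definition dependent_bases (T : finType) (M : matroid T) : {set {set T}} :=
  [set A : {set T} |
    [&& A \subset ground M, #|A| == rank M & (rk M A < rank M)%N]].

(** The induction invariant that replaces [sparse_paving]. A relaxation alters only a set of size
    [rank M], so it is preserved without a study of the circuits and hyperplanes of the relaxed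
    matroid. *)
Definition uniform_off_rank (T : finType) (M : matroid T) : Prop :=
  forall A : {set T}, A \subset ground M -> #|A| != rank M ->
    rk M A = minn #|A| (rank M).

(** A dependent set contains a circuit, hence has at least [rank M] elements. A set of more than
    [rank M] elements and deficient rank would have a hyperplane as closure, which is too large. *)
Lemma sparse_paving_uniform_off_rank (T : finType) (M : matroid T) :
  sparse_paving M -> uniform_off_rank M.
Proof.
case=> pav hyp.
have small (A : {set T}) :
    A \subset ground M -> (#|A| < rank M)%N -> rk M A = #|A|.
  move=> sA cA; apply/eqP; apply: contraTT cA => rA; rewrite -leqNgt.
  have [C minC sC] := @minset_exists _
    [pred A : {set T} | (A \subset ground M) && ~~ indep M A] A
    ltac:(by rewrite /= /indep sA).
  exact: leq_trans (pav C minC) (subset_leq_card sC).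
move=> A sA; rewrite neq_ltn => /orP[cA|cA]; first by rewrite small //; lia.
apply/eqP; rewrite (minn_idPr (ltnW cA)) eqn_leq rk_le_rank leqNgt /=.
apply/negP => rA.
pose cl := [set x in ground M | rk M (x |: A) == rk M A].
have sAcl : A \subset cl.
  apply/subsetP => x xA; rewrite inE (subsetP sA) //=.
  by rewrite (setUidPr _) // sub1set.
have rcl : rk M cl = rk M A.
  rewrite -(setUidPl sAcl); apply: rk_closure => x.
  by rewrite inE => /andP[_ /eqP].
suff /hyp : hyperplane M cl.
  by have := subset_leq_card sAcl; lia.
apply/andP; split; first (apply/andP; split).
- by apply/subsetP => x; rewrite inE => /andP[].
- apply/forall_inP => x; rewrite !inE => /andP[+ xE]; rewrite xE /= => nx.
  rewrite rcl ltn_neqAle rkS ?andbT; last first.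
    exact: subset_trans sAcl (subsetUr _ _).
  apply: contra nx => /eqP e; rewrite eqn_leq [leqRHS]e.
  by rewrite rkS ?setUS //= rkS // subsetUr.
(* Already known to be independent, [B] bounds the rank of [cl] from below by [rank M - 1]. *)
- have [B sB cB] : exists2 B : {set T}, B \subset A & #|B| = (rank M).-1.
    have /card_geqP[s [us ss sub]] : ((rank M).-1 <= #|A|)%N by lia.
    exists [set x in s].
      by apply/subsetP => x; rewrite inE => /sub.
    by rewrite cardsE (card_uniqP us).
  have := rkS M sB; rewrite small ?cB; [|exact: subset_trans sB sA|by lia].
  by rewrite rcl; lia.
Qed.

Lemma circuit_hyperplane_dependent_basis (T : finType) (M : matroid T) H :
  circuit_hyperplane M H -> H \in dependent_bases M.
Proof.
move=> chH; rewrite inE (card_circuit_hyperplane chH) eqxx.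
by case/andP: chH => _ /andP[/andP[-> _] /eqP <-] /=.
Qed.

(** Proper subsets of [H] have fewer than [rank M] elements and are independent, so [H] is a
    circuit. Adding an element gives [rank M + 1] elements and full rank, so [H] is a flat. *)
Lemma dependent_basis_circuit_hyperplane (T : finType) (M : matroid T) H :
  uniform_off_rank M -> H \in dependent_bases M -> circuit_hyperplane M H.
Proof.
move=> uM; rewrite inE => /and3P[sH /eqP cH rH].
have rH1 : (rk M H).+1 = rank M.
  have [H0|[x xH]] := set_0Vmem H.
    by move: rH; rewrite -cH H0 cards0.
  have := rkS M (subsetDl H [set x]); have := cardsD1 x H; rewrite xH => c1.
  rewrite uM; [|exact: subset_trans (subsetDl _ _) sH|by lia].
  by lia.
apply/andP; split; last (apply/andP; split; last exact/eqP).
- apply/minsetP; split; first by rewrite /= /indep sH /=; lia.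
  move=> A /andP[sA]; rewrite /indep sA /= => rA sAH; apply/eqP.
  rewrite eqEcard sAH /= leqNgt; apply: contra rA => cA.
  by rewrite uM //; lia.
- apply/andP; split=> //; apply/forall_inP => x; rewrite inE => /andP[xH xE].
  rewrite [rk M (x |: H)]uM ?cardsU1 ?xH ?subUset ?sub1set ?xE ?sH //; lia.
Qed.

Lemma dependent_bases_relax (T : finType) (M : matroid T) H
    (chH : circuit_hyperplane M H) :
  dependent_bases (relax chH) = dependent_bases M :\ H.
Proof.
apply/setP => A; rewrite in_setD1 !inE rank_relax /=.
case: (boolP (A \subset ground M)) => [sA|]; last by rewrite !andbF.
by rewrite rk_relax //; case: (eqVneq A H) => _; rewrite ?ltnn ?andbF.
Qed.

Lemma uniform_off_rank_relax (T : finType) (M : matroid T) H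
    (chH : circuit_hyperplane M H) :
  uniform_off_rank M -> uniform_off_rank (relax chH).
Proof.
move=> uM A sA; rewrite rank_relax => cA; rewrite rk_relax // -uM //.
by case: (eqVneq A H) cA => // ->; rewrite (card_circuit_hyperplane chH) eqxx.
Qed.

(** With no dependent set of size [rank M], the uniform rank formula holds at that size too.
    Enumerating the ground set supplies the map. *)
Lemma uniform_embedding (T : finType) (M : matroid T) :
  uniform_off_rank M -> dependent_bases M = set0 ->
  embedding (enum_val : 'I_#|ground M| -> T) (uniform (rank M) #|ground M|) M.
Proof.
move=> uM dM.
have eE : enum_val @: [set: 'I_#|ground M|] = ground M.
  apply/setP => x; apply/imsetP/idP => [[i _ ->]|xE]; first exact: enum_valP.
  by exists (enum_rank_in xE x); rewrite ?enum_rankK_in.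
split=> //; first exact: enum_val_inj.
move=> A _; rewrite ffunE.
rewrite -(card_imset (mem A) (@enum_val_inj _ (mem (ground M)))).
have sA : enum_val @: A \subset ground M.
  by apply/subsetP => _ /imsetP[i _ ->]; apply: enum_valP.
have [cA|cA] := eqVneq #|enum_val @: A| (rank M); last exact: uM.
rewrite cA minnn; apply/eqP; rewrite eqn_leq rk_le_rank leqNgt.
apply/negP => rA; have : enum_val @: A \in dependent_bases M.
  by rewrite inE sA cA eqxx.
by rewrite dM inE.
Qed.

(** Stated for an abstract invariant so that one induction, on the number of dependent sets of size
    [rank M], serves [P], [Q] and [Z]. Isomorphism invariance enters at the base case. *)
Lemma relaxation_increment_sparse_paving (f : matroid_poly) (k : nat)
    (p : {poly int}) (T : finType) (M : matroid T) :
  iso_invariant f -> relaxation_increment f k p ->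
  rank M = k -> sparse_paving M ->
  f T M = f _ (uniform k #|ground M|) - p *+ #|circuit_hyperplanes M|.
Proof.
move=> fI fp rM /sparse_paving_uniform_off_rank uM.
have -> : circuit_hyperplanes M = dependent_bases M.
  apply/setP => H; rewrite inE; apply/idP/idP.
    exact: circuit_hyperplane_dependent_basis.
  exact: dependent_basis_circuit_hyperplane.
have [m cM] : exists m, #|dependent_bases M| = m by eexists.
rewrite cM; elim: m M rM uM cM => [|m IH] M rM uM.
  move/eqP; rewrite cards_eq0 => /eqP dM; rewrite -rM mulr0n subr0.
  exact: fI (uniform_embedding uM dM).
move=> cM; have [H HM] : exists H, H \in dependent_bases M.
  by apply/card_gt0P; rewrite cM.
have chH := dependent_basis_circuit_hyperplane uM HM.
(* The relaxed matroid has one dependent set fewer; solving for [f T M] costs one more [p]. *)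
have := fp _ _ _ _ rM (relaxation_relax chH).
rewrite (IH (relax chH)) /= ?rank_relax //.
- by move=> e; rewrite mulrSr opprD addrA e addrK.
- exact: uniform_off_rank_relax.
- rewrite dependent_bases_relax.
  by have := cardsD1 H (dependent_bases M); rewrite HM cM => -[].
Qed.

Theorem theorem5p2
  (P Q : matroid_poly) (hP : is_KL P) (hQ : is_inverse_KL Q)
  (k : nat) (hk : (1 <= k)%N)
  (p q z : {poly int})
  (hp : relaxation_increment P k p)
  (hq : relaxation_increment Q k q)
  (hz : relaxation_increment (Zpoly P) k z)
  (n lambda : nat) (T : finType) (M : matroid T)
  (hrank : rank M = k) (hcard : #|ground M| = n)
  (hsparse : sparse_paving M)
  (hlambda : #|circuit_hyperplanes M| = lambda) :
  [/\ P T M = P _ (uniform k n) - p *+ lambda,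
      Q T M = Q _ (uniform k n) - q *+ lambda
    & Zpoly P M = Zpoly P (uniform k n) - z *+ lambda].
Proof.
have iP := is_KL_iso_invariant hP.
have iQ := is_inverse_KL_iso_invariant hQ.
rewrite -hcard -hlambda; split.
- exact: (relaxation_increment_sparse_paving iP hp).
- exact: (relaxation_increment_sparse_paving iQ hq).
- exact: (relaxation_increment_sparse_paving (Zpoly_iso_invariant iP) hz).
Qed.
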